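(* Assume the weak unobstructedness assumption stated in the context. Then the element $$\tau:=\sum_{i=1}^n -\sqrt{-1}\,y_i\otimes e_i$$ (which is independent of the choice of affine coordinates on $U$) is a Maurer–Cartan element of the tensor product curved $A_\infty$ algebra $\mathcal{O}^{\mathrm{hol}}_{TU}\otimes_{\Omega_U^*(\Lambda^\pi)}\mathcal{O}^{\omega,\mathrm{can}}_{M(U)}$; that is, denoting the structure maps of the latter by $M_k^\epsilon$, $$\sum_{k\ge 0}(-1)^{k(k-1)/2}M_k^\epsilon(\tau,\dots,\tau)=0 .$$
   Context: **Geometric data.** $(M,\omega)$ is a symplectic manifold of dimension $2n$, $\pi:M\to B$ a Lagrangian torus fibration, $U$ a small contractible open subset of its smooth locus, $M(U)=\pi^{-1}(U)$, $L_p=\pi^{-1}(p)$ for $p\in U$, and $u_0\in U$ a base point. $x_1,\dots,x_n$ are action coordinates on $U$, $y_1^\vee,\dots,y_n^\vee$ angle coordinates on the fibres, $\omega=\sum_i dx_i\wedge dy_i^\vee$ on $M(U)$, and $e_i=dy_i^\vee$ is the resulting flat integral basis of $R^1\pi_*\mathbb{Z}$. **Fukaya's operators (known, taken as given).** Fix an $\omega$-tamed almost complex structure $J$. For $p\in U$ let $\phi_p$ be the time-one flow of $\chi\sum_i (x_i(p)-x_i(u_0))\,\partial/\partial x_i$, $\chi$ a cutoff function equal to $1$ over $U$; it carries $L_{u_0}$ to $L_p$, and $U$ is small enough that $(\phi_p)_*J$ is $\omega$-tamed. Using $(\phi_p)_*J$ for $L_p$, the moduli spaces $\mathcal{M}_{k+1,\beta}$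 of stable holomorphic disks with $k+1$ boundary marked points and boundary on $L_p$ are identified for all $p$, so the operators $m_{k,\beta}(\alpha_1,\dots,\alpha_k)=(\mathrm{ev}_0)_!(\mathrm{ev}_1^*\alpha_1\wedge\cdots\wedge \mathrm{ev}_k^*\alpha_k)$ on $\Omega^*(L_p,\mathbb{C})$, of degree $2-k-\mu(\beta)$, do not depend on $p$. $G$ is the (trivialized) local system of monoids of disk classes $\beta$ generated by those with non-empty moduli space; $\beta$ has energy $\int_\beta\omega$, Maslov index $\mu(\beta)\in 2\mathbb{Z}$ and boundary $\partial\beta\in H_1(L_p,\mathbb{Z})$. The relative Novikov ring is $\Lambda^\pi=\{\sum_i a_iT^{\beta_i}: a_i\in\mathbb{C},\ \beta_i\in G,\ \#\{i: a_i\ne 0,\ \int_{\beta_i}\omega|_{u_0}\le E\}<\infty\ \forall E\in\mathbb{R}\}$, with $T^\beta$ of degree $\mu(\beta)$. Put $m_k=\sum_{\beta\in G} m_{k,\beta}T^\beta$, extended $\Lambda^\pi$-linearly. It is known (Fukaya–Oh–Ohta–Ono, Fukaya) that the $m_k$ form an $A_\infty$ structure (of degree one on the shifted complex, $\sum m_{r+1+t}(\mathrm{id}^{r}\otimes m_s\otimes\mathrm{id}^t)=0$), with strict unit $\mathbf{1}$, cyclic for the Poincaré pairing, with $\beta=0$ part the de Rham algebra, and satisfying the divisor equation $\sum_{l_0+\cdots+l_k=l} m_{k+l,\beta}(b^{\otimes l_0},\alpha_1,b^{\otimes l_1},\dots,\alpha_k,b^{\otimes l_k})=\frac{1}{l!}\langle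 b,\partial\beta\rangle^l m_{k,\beta}(\alpha_1,\dots,\alpha_k)$ for a degree-one class $b$. The same holds for the canonical (minimal) model on $H^*(L_p,\Lambda^\pi)$, which is used here; its $\beta=0$ part is the exterior algebra $H^*(L_p,\mathbb{C})$. The other sign convention is $m_k(a_1\otimes\cdots\otimes a_k)=(-1)^{\epsilon_k}m_k^\epsilon(a_1\otimes\cdots\otimes a_k)$, $\epsilon_k=\sum_{i=1}^{k-1}(k-i)|a_i|$. **$\mathcal{O}^{\omega,\mathrm{can}}_{M(U)}$.** $\mathcal{H}=R\pi_*\Lambda^\pi\otimes C_U^\infty$ has fibre $H^*(L_p,\Lambda^\pi)$, with $m_k$ acting $C^\infty_U$-linearly and Gauss–Manin connection $\nabla$ given by $\nabla e_i=0$, $\nabla(T^\beta)=-\sum_i\langle\partial\beta,e_i\rangle T^\beta dx_i$ and the Leibniz rule. On $\mathcal{H}\otimes_{C^\infty_U}\Omega_U^*$ put $\nabla(f\otimes\alpha)=(\nabla f)\wedge\alpha+(-1)^{|f|}f\otimes d\alpha$ and $m_k^\epsilon(f_1\otimes\alpha_1,\dots,f_k\otimes\alpha_k)=(-1)^{\eta_k}m_k^\epsilon(f_1,\dots,f_k)\otimes(\alpha_1\wedge\cdots\wedge\alpha_k)$, $\eta_k=\sum_{i=1}^{k-1}|\alpha_i|(|f_{i+1}|+\cdots+|f_k|)$. With $\omega=-\sum_i e_i\otimes dx_i$, $\mathcal{O}^{\omega,\mathrm{can}}$ is the curved $A_\infty$ algebra on this complex with $\hat m_0^\epsilon=m_0^\epsilon-\omega$,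 $\hat m_1^\epsilon=m_1^\epsilon+\nabla$, $\hat m_k^\epsilon=m_k^\epsilon$ $(k\ge2)$. **Weak unobstructedness assumption.** For every $p\in U$ the $m_0$ term of $H^*(L_p,\Lambda^\pi)$ is a scalar multiple of $\mathbf{1}$. Consequently for $b\in H^1(L_p,\Lambda^\pi)$, $\sum_{k\ge 0}m_k(b^{\otimes k})=W(p,b)\mathbf{1}$ for a scalar $W(p,b)$ (the potential function). **$\mathcal{O}^{\mathrm{hol}}_{TU}$.** Let $y_1,\dots,y_n$ be the coordinates dual to the $e_i$; the tangent bundle $TU$ with coordinates $(x,y)$ is identified with the set of pairs $(p,b)$, $b\in H^1(L_p,\mathbb{C})$ purely imaginary, by $(x,y)\mapsto (x,\ b=\sum_i-\sqrt{-1}\,y_ie_i)$, so $W$ restricts to a $\Lambda^\pi$-valued function on $TU$. $C^\infty_{TU}(\Lambda^\pi)$ is the space of series $\sum_j f_jT^{\beta_j}$, $f_j\in C^\infty_{TU}$, with finitely many non-zero terms below any energy bound. On $C^\infty_{TU}(\Lambda^\pi)\otimes\Omega^*_U$ let $\bar\partial=\sum_i(\partial_{x_i}+\sqrt{-1}\,\partial_{y_i})dx_i$, where $\partial_{x_i}T^\beta=-\langle\partial\beta,e_i\rangle T^\beta$, $\partial_{y_i}T^\beta=0$. $\mathcal{O}^{\mathrm{hol}}_{TU}$ is this differential graded algebra with curvature $-W$. **Tensor product.** For a curved differential graded algebra $B$ with differential $d$ and curvature $c_B$, and an $A_\infty$ algebra $A$, the $A_\infty$ algebra $B\otimes A$ has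 operations $\mathbf{1}\otimes m_0^\epsilon+c_B\otimes\mathbf{1}$; $b\otimes a\mapsto db\otimes a+(-1)^{|b|}b\otimes m_1^\epsilon(a)$; and for $k\ge2$, $(b_1\otimes a_1,\dots,b_k\otimes a_k)\mapsto(-1)^{\sum_{i<k}|a_i|(|b_{i+1}|+\cdots+|b_k|)}(b_1\cdots b_k)\otimes m_k^\epsilon(a_1,\dots,a_k)$. *)

(* Defs.v *)
From HB Require Import structures.
From mathcomp Require Import all_boot all_order all_algebra.
From mathcomp Require Import all_classical all_reals all_analysis.
From mathcomp Require Import complex.

Set Implicit Arguments.
Unset Strict Implicit.
Unset Printing Implicit Defensive.

Import Order.TTheory GRing.Theory Num.Theory.
Import numFieldNormedType.Exports.

Local Open Scope classical_set_scope.
Local Open Scope ring_scope.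

(* Real and complex analysis on R^n and on the total space of its tangent     *)
(* bundle.  Derivatives, limits and sums of R[i]-valued functions are taken   *)
(* on real and imaginary parts.                                               *)

Section Analysis.
Variable R : realType.
Local Notation C := R[i].

Fixpoint Ck (V : normedModType R) (D : set V) (k : nat) (f : V -> R) : Prop :=
  (forall p, D p -> {for p, continuous f}) /\
  if k is k'.+1 then
    forall v : V, (forall p, D p -> derivable f p v) /\
                  Ck D k' (fun p => 'D_v f p)
  else True.

Definition smooth (V : normedModType R) (D : set V) (f : V -> C) : Prop :=
  forall k, Ck D k (fun p => complex.Re (f p)) /\
            Ck D k (fun p => complex.Im (f p)).

Definition cderive (V : normedModType R) (f : V -> C) (v p : V) : C :=
  Complex ('D_v (fun q => complex.Re (f q)) p)
          ('D_v (fun q => complex.Im (f q)) p).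

Definition csum_to (u : nat -> C) (s : C) : Prop :=
  (series (fun k => complex.Re (u k)) @ \oo --> complex.Re s) /\
  (series (fun k => complex.Im (u k)) @ \oo --> complex.Im s).

Definition csum (u : nat -> C) : C :=
  Complex (limn (series (fun k => complex.Re (u k))))
          (limn (series (fun k => complex.Im (u k)))).

Definition contractible (V : normedModType R) (D : set V) : Prop :=
  exists (c : V) (h : R * V -> V),
    [/\ D c,
        {within [set q : R * V | 0 <= q.1 <= 1 /\ D q.2], continuous h},
        (forall t x, 0 <= t <= 1 -> D x -> D (h (t, x))),
        (forall x, D x -> h (0, x) = x) &
        (forall x, D x -> h (1, x) = c)].

End Analysis.

(* The exterior algebra on n generators, with basis e_I indexed by subsets    *)
(* I of 'I_n: e_I is the product of the e_i, i in I, in increasing order.     *)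

Section Exterior.
Variables (R : realType) (n : nat).
Local Notation C := R[i].

Definition ext : Type := {ffun {set 'I_n} -> C^o}.
HB.instance Definition _ := GRing.Lmodule.on ext.

Definition ebasis (I : {set 'I_n}) : ext := [ffun J => (J == I)%:R].
Definition eone : ext := ebasis finset.set0.

(* e_I e_J = wsign I J e_(I u J) *)
Definition wsign (I J : {set 'I_n}) : C :=
  if [disjoint I & J] then
    (-1) ^+ #|[pred ij : 'I_n * 'I_n |
               [&& ij.1 \in I, ij.2 \in J & (ij.2 < ij.1)%N]]|
  else 0.

Definition ewedge (a b : ext) : ext :=
  [ffun K => \sum_(I : {set 'I_n}) \sum_(J : {set 'I_n} | I :|: J == K)
               wsign I J * a I * b J].

(* a |-> (-1)^(m |a|) a *)
Definition etwist (m : nat) (a : ext) : ext :=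
  [ffun I : {set 'I_n} => (-1) ^+ (m * #|I|) * a I].

(* a |-> (-1)^|a|' a, where |a|' = |a| - 1 is the shifted degree *)
Definition etwist_shifted (a : ext) : ext := - etwist 1 a.

Definition eclass1 (v : 'I_n -> C) : ext :=
  \sum_(i < n) v i *: (ebasis [set i]%SET : ext).

(* Integration over the torus reads off the coefficient of e_1 ... e_n; the   *)
(* sign (-1)^|a| is the one for which the products a, b |-> (-1)^|a| a b are  *)
(* cyclic for shifted degrees.                                                *)
Definition poincare_pairing (a b : ext) : C :=
  ewedge (etwist 1 a) b [set: 'I_n]%SET.

End Exterior.

Arguments ebasis {R n} I.
Arguments eone {R n}.
Arguments wsign {R n} I J.

(* insert_class b [:: l_0; ..; l_k] [:: a_1; ..; a_k] is the list             *)
(* b^(l_0), a_1, b^(l_1), .., a_k, b^(l_k)                                    *)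
Fixpoint insert_class (T : Type) (b : T) (l : seq nat) (a : seq T) : seq T :=
  match l, a with
  | l0 :: l', a1 :: a' => nseq l0 b ++ a1 :: insert_class b l' a'
  | l0 :: _, [::] => nseq l0 b
  | [::], _ => a
  end.

(* [:: tw (w 0) s_0; tw (w 1) s_1; ..] *)
Definition twist_seq (T : Type) (x0 : T) (tw : nat -> T -> T) (w : nat -> nat)
    (s : seq T) : seq T :=
  mkseq (fun j => tw (w j) (nth x0 s j)) (size s).

(* The sum of the first j entries: sum_(i < j) d_i, the Koszul weight of the  *)
(* j-th factor when d lists the degrees of the elements that move past it.    *)
Definition psum (d : seq nat) (j : nat) : nat := sumn (take j d).

(* The symplectic input of a Lagrangian torus fibration over U, in fixed      *)
(* action-angle coordinates: U is an open subset of R^n via x_1, .., x_n, the *)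
(* cohomology of every fibre is identified with the exterior algebra by the   *)
(* flat basis e_1, .., e_n, and H_1 of every fibre with Z^n by the dual basis.*)
(* The operators are those of the canonical model.                            *)
Record fukaya_data (R : realType) (n : nat) : Type := FukayaData {
  base : set 'rV[R]_n;
  base_open : open base;
  base_contractible : contractible base;
  base_point : 'rV[R]_n;
  base_pointP : base base_point;

  (* the monoid of disk classes, generated by those with non-empty moduli *)
  disk : nmodType;
  has_disks : set disk;
  disk_generated : forall S : set disk,
    S 0 -> (forall b c, S b -> S c -> S (b + c)) -> has_disks `<=` S ->
    S = setT;

  (* area p b is the integral of omega over b in the fibre over p *)
  area : 'rV[R]_n -> disk -> R;
  maslov : disk -> int;
  bdry : disk -> 'rV[int]_n;
  area0 : forall p, area p 0 = 0;
  areaD : forall p b c, area p (b + c) = area p b + area p c;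
  maslov0 : maslov 0 = 0;
  maslovD : forall b c, maslov (b + c) = maslov b + maslov c;
  maslov_even : forall b, (2 %| maslov b)%Z;
  bdry0 : bdry 0 = 0;
  bdryD : forall b c, bdry (b + c) = bdry b + bdry c;
  (* holomorphic disks have positive area, Gromov compactness, Stokes *)
  area_gt0 : forall p b, base p -> has_disks b -> b != 0 -> 0 < area p b;
  area_finite : forall p E, base p ->
    finite_set [set b | has_disks b /\ area p b <= E];
  area_flux : forall p q b, base p -> base q ->
    area q b - area p b = \sum_(i < n) (bdry b 0 i)%:~R * (q 0 i - p 0 i);

  (* op p b [:: a_1; ..; a_k] is m_{k,b}(a_1, .., a_k) on the fibre over p *)
  op : 'rV[R]_n -> disk -> seq (ext R n) -> ext R n;
  op_indep : forall p q b s, base p -> base q -> op p b s = op q b s;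
  op_linear : forall p b (s t : seq (ext R n)) (c : R[i]) (u v : ext R n),
    base p ->
    op p b (s ++ (c *: u + v) :: t) =
      c *: op p b (s ++ u :: t) + op p b (s ++ v :: t);
  op_degree : forall p b (Is : seq {set 'I_n}) (J : {set 'I_n}), base p ->
    op p b (map ebasis Is) J != 0 ->
    (#|J|%:Z + maslov b + (size Is)%:Z =
       2 + (sumn [seq #|(Q : {set 'I_n})| | Q <- Is])%:Z)%R;
  op_ainf : forall p g (a : seq (ext R n)), base p ->
    \sum_(w \in [set w : disk * disk | w.1 + w.2 = g])
      \sum_(0 <= r < (size a).+1) \sum_(0 <= s < (size a - r).+1)
        op p w.1 ([seq etwist_shifted x | x <- take r a] ++
                  op p w.2 (take s (drop r a)) :: drop (r + s) a) = 0;
  op_unit : forall p b s t, base p -> size (s ++ t) != 1%N ->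
    op p b (s ++ eone :: t) = 0;
  op_unitl : forall p b a, base p ->
    op p b [:: eone; a] = if b == 0 then a else 0;
  op_unitr : forall p b a, base p ->
    op p b [:: a; eone] = if b == 0 then etwist 1 a else 0;
  op_cyclic : forall p b (Is : seq {set 'I_n}) (J K : {set 'I_n}), base p ->
    poincare_pairing (op p b (map ebasis (rcons Is J))) (ebasis K) =
      (-1) ^+ (#|K|.+1 * sumn [seq #|(Q : {set 'I_n})|.+1 | Q <- rcons Is J]) *
      poincare_pairing (op p b (map ebasis (K :: Is))) (ebasis J);
  op_zero2 : forall p u v, base p -> op p 0 [:: u; v] = ewedge (etwist 1 u) v;
  op_zero : forall p s, base p -> size s != 2%N -> op p 0 s = 0;
  op_divisor : forall p b (v : 'I_n -> R[i]) (a : seq (ext R n)) (l : nat),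
    base p ->
    \sum_(t : (size a).+1.-tuple 'I_l.+1 | sumn (map val t) == l)
       op p b (insert_class (eclass1 v) (map val t) a) =
    ((\sum_(i < n) v i * (bdry b 0 i)%:~R) ^+ l / (l`!)%:R : R[i]) *: op p b a
}.

Arguments op {R n} f p b s.

Section Algebras.
Variables (R : realType) (n : nat) (X : fukaya_data R n).
Local Notation C := R[i].
Local Notation pt := 'rV[R]_n.
Local Notation E := (ext R n).
Local Notation G := (disk X).

(* A series sum_b f_b T^b is represented by its coefficient function b |-> f_b.*)
(* The relative Novikov ring consists of those with finitely many non-zero    *)
(* coefficients below every energy level at the base point.  Operations are   *)
(* written on all coefficient families; finiteness of the sums over classes   *)
(* follows from area_finite, area_gt0 and disk_generated.                     *)
Definition novikov (V : zmodType) (f : G -> V) : Prop :=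
  forall e : R, finite_set [set b | f b != 0 /\ area (base_point X) b <= e].

(* m_k = sum_b m_{k,b} T^b, extended linearly over the Novikov ring *)
Definition mL (p : pt) (s : seq (G -> E)) : G -> E := fun g =>
  \sum_(w \in [set w : G * seq G |
               size w.2 = size s /\ w.1 + \sum_(b <- w.2) b = g])
    op X p w.1 [seq ab.1 ab.2 | ab <- zip s w.2].

(* T^b has even degree and does not contribute to signs. *)
Definition ltwist (m : nat) (f : G -> E) : G -> E := fun b => etwist m (f b).

(* m_k = (-1)^(eps_k) m_k^eps with eps_k = sum_i (k - i) |a_i| *)
Definition mLeps (p : pt) (s : seq (G -> E)) : G -> E :=
  mL p (twist_seq 0 ltwist (fun j => size s - j.+1)%N s).

Definition weakly_unobstructed : Prop :=
  forall p, base X p -> exists c : G -> C,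
    novikov (c : G -> C^o) /\ mL p [::] = (fun b => (c b : C) *: (eone : E)).

(* W(p, b) is the coefficient of 1 in sum_k m_k(b, .., b) *)
Definition potential (p : pt) (b : G -> E) : G -> C := fun g =>
  csum (fun k => mL p (nseq k b) g finset.set0).

(* The curved A_infty algebra on H (x) Omega_U: a x J b is the coefficient of *)
(* T^b dx_J at x, an element of the cohomology of the fibre, written to the   *)
(* left of dx_J.                                                              *)
Definition ocan : Type := pt -> {set 'I_n} -> G -> E.

Definition ocan_basis (I : {set 'I_n}) : ocan := fun _ J b =>
  if (J == finset.set0) && (b == 0) then ebasis I else 0.

Definition ocan_one : ocan := ocan_basis finset.set0.

(* The extension of m_k^eps to H (x) Omega_U; the twist is the sign eta_k. *)
Definition ocan_m (s : seq ocan) : ocan := fun x K g =>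
  \sum_(J : (size s).-tuple {set 'I_n})
    ((foldr (@ewedge R n) eone (map ebasis J)) K : C) *:
    mLeps x (twist_seq 0 ltwist
               (psum [seq #|(Q : {set 'I_n})| | Q <- J])
               [seq aJ.1 x aJ.2 | aJ <- zip s J]) g.

(* omega = - sum_i e_i (x) dx_i *)
Definition ocan_omega : ocan := fun _ J b =>
  if b == 0 then - \sum_(i < n) (J == [set i]%SET)%:R *: (ebasis [set i]%SET : E)
  else 0.

(* d f - f sum_i <bdry b, e_i> dx_i is the derivative of f T^b; the sign      *)
(* (-1)^|I| comes from moving dx_i past e_I in nabla (f T^b e_I (x) dx_J),    *)
(* as the formula nabla (f (x) a) = nabla f a + (-1)^|f| f (x) d a and        *)
(* linearity over the functions on U require.                                 *)
Definition ocan_nabla (a : ocan) : ocan := fun x K b =>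
  [ffun I : {set 'I_n} => (-1) ^+ #|I| *
    \sum_(i < n | i \in K) wsign [set i]%SET (K :\ i)%SET *
      (cderive (fun z => a z (K :\ i)%SET b I) (delta_mx 0 i) x
       - (bdry b 0 i)%:~R * a x (K :\ i)%SET b I)].

Definition ocan_op (s : seq ocan) : ocan :=
  match s with
  | [::] => fun x K b => ocan_m [::] x K b - ocan_omega x K b
  | [:: a] => fun x K b => ocan_m [:: a] x K b + ocan_nabla a x K b
  | _ => ocan_m s
  end.

(* The curved differential graded algebra on TU: f (x, y) J b is the          *)
(* coefficient of T^b dx_J at the point with base coordinates x and fibre     *)
(* coordinates y.                                                             *)
Definition tangent_base : set (pt * pt) := [set z | base X z.1].

Definition ohol : Type := pt * pt -> {set 'I_n} -> G -> C.

Definition ohol_carrier (f : ohol) : Prop := forall J,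
  (forall b, smooth tangent_base (fun z => f z J b)) /\
  forall e : R, finite_set [set b | (exists2 z, tangent_base z & f z J b != 0) /\
                                    area (base_point X) b <= e].

Definition ohol_fun (f : pt * pt -> C) : ohol := fun z J b =>
  if (J == finset.set0) && (b == 0) then f z else 0.

Definition ohol_one : ohol := ohol_fun (fun _ => 1).

Definition ohol_mul (f g : ohol) : ohol := fun z K c =>
  \sum_(I : {set 'I_n}) \sum_(J : {set 'I_n} | I :|: J == K)
    wsign I J *
    \sum_(w \in [set w : G * G | w.1 + w.2 = c]) (f z I w.1 * g z J w.2 : C^o).

(* f |-> (-1)^(m |f|) f *)
Definition ohol_twist (m : nat) (f : ohol) : ohol := fun z J b =>
  (-1) ^+ (m * #|J|) * f z J b.

Definition ohol_dbar (f : ohol) : ohol := fun z K b =>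
  \sum_(i < n | i \in K) wsign [set i]%SET (K :\ i)%SET *
    (cderive (fun q => f q (K :\ i)%SET b) (delta_mx 0 i, 0) z
     - (bdry b 0 i)%:~R * f z (K :\ i)%SET b
     + 'i%C * cderive (fun q => f q (K :\ i)%SET b) (0, delta_mx 0 i) z).

(* (x, y) |-> b = sum_i - sqrt(-1) y_i e_i *)
Definition tangent_class (y : pt) : G -> E := fun b =>
  if b == 0 then eclass1 (fun i => - 'i%C * (y 0 i)%:C%C) else 0.

Definition ohol_curv : ohol := fun z J b =>
  if J == finset.set0 then - potential z.1 (tangent_class z.2) b else 0.

(* The tensor product over Omega_U(Lambda).  Over this algebra ocan is free   *)
(* on the e_I, so an element is sum_I f_I (x) e_I with f_I in ohol; t I is    *)
(* the coefficient f_I.                                                       *)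
Definition otens : Type := {set 'I_n} -> ohol.

Definition otens_carrier (t : otens) : Prop := forall I, ohol_carrier (t I).

Definition otens_homogeneous (d : int) (t : otens) : Prop :=
  forall I z J b, tangent_base z -> t I z J b != 0 ->
    #|I|%:Z + #|J|%:Z + maslov b = d.

(* the pure tensor f (x) a: e_I (x) theta = (-1)^(|I||theta|) theta e_I in    *)
(* ocan, and theta then moves to the left factor through pull-back along      *)
(* TU -> U                                                                    *)
Definition otens_pure (f : ohol) (a : ocan) : otens := fun I =>
  ohol_mul f (ohol_twist #|I| (fun z J b => a z.1 J b I)).

Definition otens_op (s : seq otens) : otens :=
  match s with
  | [::] => fun I z J b =>
      otens_pure ohol_one (ocan_op [::]) I z J b
      + otens_pure ohol_curv ocan_one I z J b
  | [:: t] => fun I z J b =>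
      \sum_(K : {set 'I_n})
        (otens_pure (ohol_dbar (t K)) (ocan_basis K) I z J b
         + otens_pure (ohol_twist 1 (t K)) (ocan_op [:: ocan_basis K]) I z J b)
  | _ => fun I z J b =>
      \sum_(Ks : (size s).-tuple {set 'I_n})
        otens_pure
          (foldr ohol_mul ohol_one
             (twist_seq ohol_one ohol_twist
                (psum [seq #|(Q : {set 'I_n})| | Q <- Ks])
                [seq tK.1 tK.2 | tK <- zip s Ks]))
          (ocan_op (map ocan_basis Ks)) I z J b
  end.

(* The sum over k is infinite in every fixed power of T and is taken          *)
(* coefficientwise, pointwise on TU.                                          *)
Definition maurer_cartan (t : otens) : Prop :=
  [/\ otens_carrier t,
      otens_homogeneous 1 t &
      forall I z J b, tangent_base z ->
        csum_to (fun k => (-1) ^+ ((k * k.-1)./2) * otens_op (nseq k t) I z J b)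
                0].

(* sum_i - sqrt(-1) y_i (x) e_i for fibre coordinates y_i on TU and degree    *)
(* one classes e_i                                                            *)
Definition tau_of (y : 'I_n -> pt * pt -> R) (e : 'I_n -> E) : otens :=
  fun I z J b => \sum_(i < n)
    otens_pure (ohol_fun (fun q => - 'i%C * (y i q)%:C%C))
               (fun _ K c => if (K == finset.set0) && (c == 0) then e i else 0) I z J b.

Definition tau : otens :=
  tau_of (fun i z => z.2 0 i) (fun i => ebasis [set i]%SET).

(* The affine coordinates x'_i = sum_j A_ij x_j + c_i, with A in GL_n(Z),     *)
(* have flat basis e' determined by sum_i e'_i (x) dx'_i = sum_j e_j (x) dx_j *)
(* and fibre coordinates y'_i = dx'_i(sum_j y_j d/dx_j).                      *)
Definition affine_change (A : 'M[int]_n) (y' : 'I_n -> pt * pt -> R)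
    (e' : 'I_n -> E) : Prop :=
  [/\ A \in unitmx,
      (forall i z, y' i z = \sum_(j < n) (A i j)%:~R * z.2 0 j) &
      (forall j, ebasis [set j]%SET = \sum_(i < n) (A i j)%:~R *: e' i)].

End Algebras.

Arguments tau_of {R n} X y e.
Arguments tau {R n} X.

(* Main.v *)
(* By multilinearity, M_k^eps(tau, ..., tau) is m_k(b, ..., b) up to the sign
   (-1)^(k(k-1)/2), where b = sum_i - sqrt(-1) y_i e_i is the class attached to
   the point of TU; so these terms add up to the potential W, which the
   curvature -W cancels.  The two remaining contributions cancel as well:
   dbar tau = sum_i dx_i (x) e_i against the curvature -omega.  The divisor
   equation turns the series m_{k,beta}(b, ..., b) into an exponential series,
   hence it converges, and weak unobstructedness makes it a multiple of 1. *)

Require Import Defs.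
From mathcomp Require Import all_boot all_order all_algebra.
From mathcomp Require Import all_classical all_reals all_analysis.
From mathcomp Require Import complex ring.

Set Implicit Arguments.
Unset Strict Implicit.
Unset Printing Implicit Defensive.

Import Order.TTheory GRing.Theory Num.Theory.
Import numFieldNormedType.Exports.

Local Open Scope classical_set_scope.
Local Open Scope ring_scope.

(** * Complex exponential series and corrections of leading terms *)

(** Comparison test: the real part is bounded by the norm, which is |c| times the k-th term of the
    real series of exp |z|. *)
Lemma cvg_series_Re_exp (R : realType) (z c : R[i]) :
  cvgn (series (fun k => complex.Re (z ^+ k / (k`!)%:R * c))).
Proof.
(* The norm on [R[i]] takes values in [R[i]]; a real representative is needed to compare with a real
   series. *)
have absE (w : R[i]) : exists2 a : R, 0 <= a & `|w| = a%:C%C.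
  have wE : (complex.Re `|w|)%:C%C = `|w| by rewrite RRe_real ?normr_real.
  by exists (complex.Re `|w|); rewrite // -lecR wE normr_ge0.
have [a a0 az] := absE z; have [b b0 bc] := absE c.
apply: normed_cvg.
have := @is_cvg_seriesZ _ _ b (is_cvg_series_exp_coeff a).
have bE k : (b *: exp_coeff a) k = b * (a ^+ k / k`!%:R) by [].
apply: series_le_cvg => k; rewrite ?bE /=; first exact: normr_ge0.
  by rewrite mulr_ge0 // divr_ge0 ?exprn_ge0.
rewrite -lecR (le_trans (normc_ge_Re _)) //.
rewrite !normrM normrV ?unitfE ?pnatr_eq0 -?lt0n ?fact_gt0 // normrX normr_nat.
by rewrite az bc !rmorphM /= fmorphV rmorph_nat rmorphXn /= mulrC.
Qed.

(** Since Im w = Re (-'i w), the factor -'i can be absorbed into [c]. *)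
Lemma cvg_series_Im_exp (R : realType) (z c : R[i]) :
  cvgn (series (fun k => complex.Im (z ^+ k / (k`!)%:R * c))).
Proof.
have ImE (w : R[i]) : complex.Im w = complex.Re (w * - 'i%C).
  by case: w => a b /=; ring.
under eq_fun do rewrite ImE -mulrA; exact: cvg_series_Re_exp.
Qed.

(* Only the terms of index 0 and 1 change, and their sum changes by -s. *)
Lemma csum_to_head (R : realType) (u : nat -> R[i]) (s e : R[i]) :
  csum_to u s ->
  csum_to (fun k => u k - (k == 0%N)%:R * (s + e) + (k == 1%N)%:R * e) 0.
Proof.
have head (v w : nat -> R) l : v 0%N + v 1%N = w 0%N + w 1%N - l ->
    (forall k, v k.+2 = w k.+2) -> series w @ \oo --> l ->
    series v @ \oo --> (0 : R).
  move=> v01 vS wl; rewrite -(subrr l) -(cvg_shiftn 2).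
  have -> : (fun k => series v (k + 2)%N) = (fun k => series w (k + 2)%N - l).
    apply/funext => k; rewrite addn2 /series /= !big_nat_recl // !addrA v01.
    by rewrite [LHS]addrAC; congr (_ + _ - _); apply: eq_bigr.
  by apply: cvgB; [rewrite (cvg_shiftn 2)|exact: cvg_cst].
case: s e => a b [c d] [ua ub].
by split; [apply: (head _ _ _ _ _ ua)|apply: (head _ _ _ _ _ ub)] => * /=;
  do ?[case: (u _) => ? ? /=]; ring.
Qed.

(** * Smoothness of continuous linear functionals *)

Section Smoothness.
Variables (R : realType) (V : normedModType R) (D : set V).

Lemma Ck_cst k (c : R) : Ck D k (fun _ : V => c).
Proof.
elim: k c => [|k IH] c; split=> //; try by move=> p _; exact: cvg_cst.
move=> v; split=> [p _|]; first exact: derivable_cst.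
have -> : (fun p => 'D_v (fun _ : V => c) p) = fun=> 0; last exact: IH.
by apply/funext => p; exact: derive_cst.
Qed.

Variable f : V -> R.
Hypothesis fD : forall (h : R) v p, f (h *: v + p) = h * f v + f p.

(** The difference quotient equals [f v] for every nonzero h, so it is constant on a punctured
    neighbourhood of 0. *)
Lemma is_derive_linear (p v : V) : is_derive p v f (f v).
Proof.
have df : h^-1 *: (f (h *: v + p) - f p) @[h --> 0^'] --> f v.
  apply: cvg_near_cst; near=> h; rewrite fD addrK -[LHS]/(_ * _).
  rewrite mulrA mulVf ?mul1r //.
  near: h; exact: nbhs_dnbhs_neq.
by apply: DeriveDef; [apply/cvg_ex; exists (f v)|exact: cvg_lim].
Unshelve. all: end_near. Qed.

(** The derivative along v is constant, so one differentiation reduces to [Ck_cst]. Continuity is a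
    separate hypothesis because [V] may have infinite dimension. *)
Lemma Ck_linear k : continuous f -> Ck D k f.
Proof.
move=> fc; case: k => [|k]; split=> //; try by move=> p _; exact: fc.
move=> v; split=> [p _|].
  exact: (@ex_derive _ _ _ _ _ _ _ (is_derive_linear p v)).
have -> : (fun p => 'D_v f p) = fun=> f v; last exact: Ck_cst.
apply/funext => p; exact: (@derive_val _ _ _ _ _ _ _ (is_derive_linear p v)).
Qed.

End Smoothness.

(** * Sums with one surviving term, sums over tuples, twisted lists *)

Lemma fsbig_only (T : choiceType) (V : nmodType) (A : set T) (F : T -> V)
    (w0 : T) : A w0 -> (forall w, A w -> w != w0 -> F w = 0) ->
  \sum_(w \in A) F w = F w0.
Proof.
move=> Aw0 F0; rewrite -(@fsbig_set1 _ _ +%R _ w0 F); apply/esym/fsbig_widen.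
  by move=> _ ->.
by move=> w [Aw /eqP]; exact: F0.
Qed.

Lemma big_tuple_cons (T : finType) (V : nmodType) n (F : n.+1.-tuple T -> V) :
  \sum_(t : n.+1.-tuple T) F t =
    \sum_x \sum_(t : n.-tuple T) F [tuple of x :: t].
Proof.
rewrite pair_bigA.
rewrite (reindex (fun u : T * n.-tuple T => [tuple of u.1 :: u.2])) //=.
exists (fun t => (thead t, [tuple of behead t])) => [[x t] _|t _] /=.
  by rewrite theadE; congr (_, _); exact: val_inj.
by rewrite -tuple_eta.
Qed.

Lemma big_tuple0 (T : finType) (V : nmodType) (F : 0.-tuple T -> V) :
  \sum_(t : 0.-tuple T) F t = F [tuple].
Proof.
rewrite (bigD1 [tuple]) //= big1 ?addr0 // => t /negP[].
by rewrite (tuple0 t).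
Qed.

Lemma twist_seq_id (T : Type) (x0 : T) (tw : nat -> T -> T) w (s : seq T) :
  (forall j, (j < size s)%N -> tw (w j) (nth x0 s j) = nth x0 s j) ->
  twist_seq x0 tw w s = s.
Proof.
move=> tws; apply: (@eq_from_nth _ x0); rewrite size_mkseq // => j js.
by rewrite nth_mkseq ?tws.
Qed.

Lemma map_twist_seq (T T' : Type) (x0 : T) (x0' : T') tw tw' w (h : T -> T')
    (s : seq T) : (forall m a, h (tw m a) = tw' m (h a)) ->
  map h (twist_seq x0 tw w s) = twist_seq x0' tw' w (map h s).
Proof.
move=> htw; apply: (@eq_from_nth _ x0'); rewrite !size_map // => j.
rewrite size_iota => js.
by rewrite (nth_map x0) ?size_mkseq // !nth_mkseq ?size_map // htw (nth_map x0).
Qed.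

(** The exponents k - 1, ..., 1, 0 are the weights in eps_k, and they add up to the binomial
    coefficient. *)
Lemma prodr_sign_triangular (S : pzRingType) k :
  \prod_(m <- mkseq (fun j => k - j.+1)%N k) (-1) ^+ m = (-1) ^+ 'C(k, 2) 
  :> S.
Proof.
rewrite prodrXr; congr (_ ^+ _).
by rewrite big_map -bin2_sum [RHS]big_nat_rev /= /index_iota subn0 add0n.
Qed.

(** * Unit, basis and grading signs of the exterior algebra *)

Section ExteriorFacts.
Variables (R : realType) (n : nat).
Local Notation C := R[i].
Local Notation E := (ext R n).

Lemma wsign0l (J : {set 'I_n}) : wsign finset.set0 J = 1 :> C.
Proof.
rewrite /wsign finset.disjoints_subset finset.sub0set eq_card0 ?expr0 // => ij.
by rewrite !inE.
Qed.

Lemma wsign0r (I : {set 'I_n}) : wsign I finset.set0 = 1 :> C.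
Proof.
rewrite /wsign disjoint_sym finset.disjoints_subset finset.sub0set.
by rewrite eq_card0 ?expr0 // => ij; rewrite !inE andbF.
Qed.

Lemma ewedge1l (a : E) : ewedge eone a = a.
Proof.
apply/ffunP => K; rewrite ffunE (bigD1 finset.set0) //=.
rewrite [X in _ + X]big1; last first.
  by move=> I I0; rewrite big1 // => J _; rewrite ffunE (negPf I0) mulr0 mul0r.
rewrite addr0 (bigD1 K) ?finset.set0U //= big1 ?addr0; last first.
  by move=> J /andP[/eqP <-]; rewrite finset.set0U eqxx.
by rewrite wsign0l ffunE eqxx !mul1r.
Qed.

Lemma etwist0 m : etwist m (0 : E) = 0.
Proof. by apply/ffunP => I; rewrite !ffunE mulr0. Qed.

Lemma etwist_degree0 (a : E) : etwist 0 a = a.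
Proof. by apply/ffunP => I; rewrite ffunE mul0n expr0 mul1r. Qed.

Lemma eclass1E (v : 'I_n -> C) (K : {set 'I_n}) :
  eclass1 v K = \sum_(i < n) v i * (K == [set i]%SET)%:R.
Proof. by rewrite sum_ffunE; apply: eq_bigr => i _; rewrite !ffunE. Qed.

Lemma eclass1_degree (v : 'I_n -> C) (K : {set 'I_n}) :
  #|K| != 1%N -> eclass1 v K = 0.
Proof.
move=> K1; rewrite eclass1E big1 // => i _; have [KE|_] := eqVneq K [set i]%SET.
  by rewrite KE finset.cards1 in K1.
by rewrite mulr0.
Qed.

Lemma ext_basis (a : E) : a = \sum_(K : {set 'I_n}) a K *: (ebasis K : E).
Proof.
apply/ffunP => I; rewrite sum_ffunE (bigD1 I) //= big1 => [|K KI].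
  by rewrite !ffunE eqxx addr0 [RHS]mulr1.
by rewrite !ffunE eq_sym (negPf KI) [LHS]mulr0.
Qed.

Lemma etwist_eclass1 m (v : 'I_n -> C) :
  etwist m (eclass1 v) = (-1) ^+ m *: (eclass1 v : E).
Proof.
apply/ffunP => K; rewrite !ffunE -[RHS]/(_ * _).
have [K1|K1] := eqVneq #|K| 1%N; first by rewrite K1 muln1.
by rewrite eclass1_degree // !mulr0.
Qed.

End ExteriorFacts.

(** * Functions on TU, pure tensors, and tau in coordinates *)

Section Tangent.
Variables (R : realType) (n : nat) (X : fukaya_data R n).
Local Notation C := R[i].
Local Notation pt := 'rV[R]_n.
Local Notation E := (ext R n).
Local Notation G := (disk X).

(** A function has form degree 0 and sits at T^0, so only I empty and the pair (0, c) of classes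
    survive, with trivial sign. *)
Lemma ohol_mulfunl (f : pt * pt -> C) (g : ohol X) :
  ohol_mul (ohol_fun f) g = fun z K c => f z * g z K c.
Proof.
apply/funext => z; apply/funext => K; apply/funext => c; rewrite /ohol_mul.
rewrite (bigD1 finset.set0) //= [X in _ + X]big1 => [|I I0]; last first.
  apply: big1 => J _; rewrite fsbig1 ?mulr0 // => w _.
  by rewrite /ohol_fun (negPf I0) /= mul0r.
rewrite addr0 (bigD1 K) ?finset.set0U //= [X in _ + X]big1 ?addr0; last first.
  by move=> J /andP[/eqP <-]; rewrite finset.set0U eqxx.
rewrite wsign0l mul1r (@fsbig_only _ _ _ _ (0, c)) /= ?add0r //.
  by rewrite /ohol_fun !eqxx.
move=> [a b] /= <- ab; rewrite /ohol_fun eqxx /=.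
by have [a0|_] := eqVneq a 0; [rewrite a0 add0r eqxx in ab|rewrite mul0r].
Qed.

Lemma ohol_mulfunr (f : pt * pt -> C) (g : ohol X) :
  ohol_mul g (ohol_fun f) = fun z K c => g z K c * f z.
Proof.
apply/funext => z; apply/funext => K; apply/funext => c; rewrite /ohol_mul.
rewrite (bigD1 K) //= [X in _ + X]big1 => [|I IK]; last first.
  apply: big1 => J /eqP IJ; rewrite fsbig1 ?mulr0 // => w _.
  rewrite /ohol_fun; case: eqP => [J0|]; last by rewrite mulr0.
  by rewrite -IJ J0 finset.setU0 eqxx in IK.
rewrite addr0 (bigD1 finset.set0) ?finset.setU0 //=.
rewrite [X in _ + X]big1 ?addr0; last first.
  move=> J /andP[_ J0]; rewrite fsbig1 ?mulr0 // => w _.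
  by rewrite /ohol_fun (negPf J0) mulr0.
rewrite wsign0r mul1r (@fsbig_only _ _ _ _ (c, 0)) /= ?addr0 //.
  by rewrite /ohol_fun !eqxx.
move=> [a b] /= <- ab; rewrite /ohol_fun eqxx /=.
by have [b0|_] := eqVneq b 0; [rewrite b0 addr0 eqxx in ab|rewrite mulr0].
Qed.

Lemma ohol_twist_fun m (f : pt * pt -> C) :
  ohol_twist m (ohol_fun f) = ohol_fun f :> ohol X.
Proof.
apply/funext => z; apply/funext => J; apply/funext => c.
rewrite /ohol_twist /ohol_fun; case: eqP => [->|]; last by rewrite mulr0.
by rewrite finset.cards0 muln0 mul1r.
Qed.

Lemma ohol_mul_fun (f g : pt * pt -> C) :
  ohol_mul (ohol_fun f) (ohol_fun g) = ohol_fun (fun z => f z * g z) :> ohol X.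
Proof.
rewrite ohol_mulfunl; apply/funext => z; apply/funext => J; apply/funext => b.
by rewrite /ohol_fun; case: ifP; rewrite ?mulr0.
Qed.

Lemma otens_pure_funl (f : pt * pt -> C) (a : ocan X) I z J b :
  otens_pure (ohol_fun f) a I z J b =
    f z * ((-1) ^+ (#|I| * #|J|) * a z.1 J b I).
Proof. by rewrite /otens_pure ohol_mulfunl. Qed.

(** Unfolds to [ocan_basis I] for [a := ebasis I], and to the constant families inside [tau_of] for
    [a := e i], so the lemmas below apply to both. *)
Definition ocan_cst (a : E) : ocan X := fun _ J b =>
  if (J == finset.set0) && (b == 0) then a else 0.

Lemma otens_pure_cstr (f : ohol X) (a : E) I z J b :
  otens_pure f (ocan_cst a) I z J b = f z J b * a I.
Proof.
rewrite /otens_pure; set g : ohol X := (X in ohol_twist _ X).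
have -> : g = ohol_fun (fun=> a I).
  apply/funext => y; apply/funext => K; apply/funext => c.
  by rewrite /g /ocan_cst /ohol_fun; case: ifP; rewrite ?ffunE.
by rewrite ohol_twist_fun ohol_mulfunr.
Qed.

(** The T^0 coefficient of [tangent_class y], whose other coefficients vanish. *)
Definition tangent_vec (y : pt) : E :=
  eclass1 (fun i => - 'i%C * (y 0 i)%:C%C).

Lemma tau_ofE (y : 'I_n -> pt * pt -> R) (e : 'I_n -> E) :
  tau_of X y e = fun I =>
    ohol_fun (fun z => \sum_(i < n) - 'i%C * (y i z)%:C%C * e i I).
Proof.
apply/funext => I; apply/funext => z; apply/funext => J; apply/funext => b.
rewrite /tau_of /ohol_fun; under eq_bigr do rewrite otens_pure_cstr.
rewrite /ohol_fun; case: ifP => // _.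
by rewrite big1 // => i _; rewrite mul0r.
Qed.

Lemma tauE : tau X = fun K => ohol_fun (fun z => tangent_vec z.2 K).
Proof.
rewrite /tau tau_ofE; apply/funext => K; congr ohol_fun; apply/funext => z.
by rewrite eclass1E; apply: eq_bigr => i _; rewrite ffunE.
Qed.

(** The y'_i and the e_j are expanded through the same matrix, so both sides are the double sum of
    A_ij y_j e'_i, up to the common factor -'i. *)
Lemma tau_of_affine (A : 'M[int]_n) (y' : 'I_n -> pt * pt -> R)
    (e' : 'I_n -> E) : affine_change A y' e' -> tau_of X y' e' = tau X.
Proof.
move=> [_ yE eE]; rewrite /tau !tau_ofE; apply/funext => I.
congr ohol_fun; apply/funext => z.
under [RHS]eq_bigr => j _ do
  rewrite [ebasis _ _](congr1 (fun a : E => a I) (eE j)) sum_ffunE mulr_sumr.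
rewrite exchange_big /=; apply: eq_bigr => i _.
rewrite yE rmorph_sum /= mulr_sumr mulr_suml; apply: eq_bigr => j _.
rewrite ffunE rmorphM /= rmorph_int -[_ *: _]/(_ * _).
by rewrite -!mulrA; congr (_ * _); rewrite mulrCA.
Qed.

(** * Multilinearity, the divisor equation, and operations on constants *)

Section Operations.
Variables (x : pt) (xU : base X x).

(** Linearity with c = -1 and u = v = 0 equates the value with a difference of two equal terms. *)
Lemma op_at0 b (s t : seq E) : op X x b (s ++ 0 :: t) = 0.
Proof.
by have := op_linear b s t (-1) 0 0 xU; rewrite scaler0 addr0 scaleN1r addNr.
Qed.

Lemma op_nth0 b (s : seq E) j :
  (j < size s)%N -> nth 0 s j = 0 -> op X x b s = 0.
Proof.
by move=> js s0; rewrite -(cat_take_drop j s) (drop_nth 0 js) s0 op_at0.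
Qed.

Lemma op_scale b (s t : seq E) c u :
  op X x b (s ++ c *: u :: t) = c *: op X x b (s ++ u :: t).
Proof. by have := op_linear b s t c u 0 xU; rewrite addr0 op_at0 addr0. Qed.

Lemma op_sum b (s t : seq E) (I : finType) (f : I -> E) :
  op X x b (s ++ (\sum_i f i) :: t) = \sum_i op X x b (s ++ f i :: t).
Proof.
apply: (big_morph (fun u => op X x b (s ++ u :: t))); last exact: op_at0.
by move=> u v; have := op_linear b s t 1 u v xU; rewrite !scale1r.
Qed.

Lemma op_scale_seq b (T : Type) (ms : seq T) (c : T -> C) (a : E) (s : seq E) :
  op X x b (s ++ [seq c m *: a | m <- ms]) =
    (\prod_(m <- ms) c m) *: op X x b (s ++ nseq (size ms) a).
Proof.
elim: ms s => [|m ms IH] s; first by rewrite big_nil scale1r.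
by rewrite /= op_scale -[in LHS]cat_rcons IH cat_rcons big_cons scalerA.
Qed.

(** The prefix [s] is arbitrary so that the induction can move each expanded argument into it. *)
Lemma op_expand b k (ms : seq nat) (a : E) (s : seq E) : size ms = k ->
  op X x b (s ++ [seq etwist m a | m <- ms]) =
    \sum_(Ks : k.-tuple {set 'I_n}) (\prod_(K <- Ks) a K) *:
      op X x b (s ++ [seq etwist mK.1 (ebasis mK.2) | mK <- zip ms Ks]).
Proof.
elim: ms k s => [|m ms IH] [|k] s //= => [_|[msk]].
  by rewrite big_tuple0 big_nil scale1r.
(* The twist is diagonal in the basis e_K. *)
have -> : etwist m a = \sum_(K : {set 'I_n}) a K *: etwist m (ebasis K).
  rewrite {1}(ext_basis a); apply/ffunP => I.
  rewrite ffunE !sum_ffunE mulr_sumr; apply: eq_bigr => K _.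
  by rewrite !ffunE -![_ *: _]/(_ * _) mulrCA.
rewrite /= op_sum big_tuple_cons; apply: eq_bigr => K _.
rewrite op_scale -cat_rcons (IH k) // scaler_sumr; apply: eq_bigr => Ks _.
by rewrite big_cons scalerA /= cat_rcons.
Qed.

(** The divisor equation with an empty list of arguments: there is a single slot, so all k copies go
    there, and l_0 = k is [ord_max]. *)
Lemma op_divisor_power b (v : 'I_n -> C) k :
  op X x b (nseq k (eclass1 v)) =
    ((\sum_(i < n) v i * (bdry b 0 i)%:~R) ^+ k / (k`!)%:R) *: op X x b [::].
Proof.
rewrite -(op_divisor b v [::] k xU) (big_pred1 [tuple ord_max]) //= => t.
case/tupleP: t => i t; rewrite (tuple0 t) /= addn0.
by rewrite -[in RHS]val_eqE /= eqseq_cons andbT -val_eqE.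
Qed.

Definition novikov_cst (V : zmodType) (a : V) : G -> V :=
  fun b => if b == 0 then a else 0.

Lemma mL_nth0 (s : seq (G -> E)) j g :
  (j < size s)%N -> nth 0 s j = 0 -> mL x s g = 0.
Proof.
move=> js sj0; apply: fsbig1 => -[b bs] /= [bss _].
apply: (@op_nth0 _ _ j); first by rewrite size_map size_zip bss minnn.
rewrite (nth_map (0, 0)) ?size_zip ?bss ?minnn //.
by rewrite nth_zip //= sj0.
Qed.

(** Only the pair (g, (0, ..., 0)) contributes: any other choice of classes evaluates some argument
    at a nonzero class, where it vanishes. *)
Lemma mL_cst (s : seq E) g : mL x (map (@novikov_cst E) s) g = op X x g s.
Proof.
rewrite /mL (@fsbig_only _ _ _ _ (g, nseq (size s) 0)) /=.
- congr op; elim: s => //= a s ->; by rewrite /novikov_cst eqxx.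
- by rewrite size_nseq size_map big_nseq iter_addr_0 mul0rn addr0.
move=> [b bs] /= [bss]; rewrite size_map in bss; rewrite -bss => bg nz.
have : ~~ all (pred1 0) bs.
  apply: contra nz => /all_pred1P bs0; rewrite bs0 size_nseq -bg bs0.
  by rewrite big_nseq iter_addr_0 mul0rn addr0.
rewrite -has_predC => /(has_nthP 0)[j js /= bj0].
apply: (@op_nth0 _ _ j).
  by rewrite size_map size_zip size_map bss minnn -bss.
rewrite (nth_map (0, 0)) ?size_zip ?size_map -?bss ?minnn //.
rewrite nth_zip ?size_map //= (nth_map 0) -?bss //.
by rewrite /novikov_cst (negPf bj0).
Qed.

Lemma mLeps_cst (s : seq E) g : mLeps x (map (@novikov_cst E) s) g =
  op X x g (twist_seq 0 (@etwist R n) (fun j => size s - j.+1)%N s).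
Proof.
rewrite /mLeps size_map -(@map_twist_seq _ _ 0 _ (@etwist R n)) ?mL_cst //.
move=> m a; apply/funext => b; rewrite /ltwist /novikov_cst; case: ifP => // _.
by rewrite etwist0.
Qed.

Lemma mLeps_nth0 (s : seq (G -> E)) j g :
  (j < size s)%N -> nth 0 s j = 0 -> mLeps x s g = 0.
Proof.
move=> js sj0; apply: (@mL_nth0 _ j); first by rewrite size_mkseq.
by rewrite nth_mkseq // sj0; apply/funext => b; exact: etwist0.
Qed.

(** Constants have only a dx_J component with J empty. On the tuple of empty sets the signs eta_k
    are trivial, and those of eps_k remain. *)
Lemma ocan_m_cst (s : seq E) K g : ocan_m (map ocan_cst s) x K g =
  (K == finset.set0)%:R *:
    op X x g (twist_seq 0 (@etwist R n) (fun j => size s - j.+1)%N s).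
Proof.
(* The length of the mapped list occurs in the type of the summation index, so it is generalised
   before being identified with [k]. *)
have [k sk] : exists k, k = size s by exists (size s).
rewrite /ocan_m; move: (size_map ocan_cst s); rewrite -sk.
move: (size (map _ _)) => k' ->.
rewrite (bigD1 [tuple of nseq k finset.set0]) //= [X in _ + X]big1 => [|J].
  rewrite addr0.
  have -> : foldr (@ewedge R n) eone (map ebasis (nseq k finset.set0)) = eone.
    by elim: (k) => //= ? ->; exact: ewedge1l.
  rewrite ffunE; congr (_ *: _).
  have -> : [seq aJ.1 x aJ.2 | aJ <- zip (map ocan_cst s) (nseq k finset.set0)]
      = map (@novikov_cst E) s.
    rewrite sk; elim: (s) => //= a s' ->; congr (_ :: _).
    by apply/funext => b; rewrite /ocan_cst eqxx.
  rewrite twist_seq_id => [|j _]; first by rewrite mLeps_cst sk.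
  have -> : psum [seq #|(Q : {set 'I_n})| | Q <- nseq k finset.set0] j = 0%N.
    rewrite /psum map_nseq finset.cards0; elim: (k) j => [|? IH] [|j] //=.
    by rewrite IH.
  by apply/funext => b; exact: etwist_degree0.
(* Some entry of this tuple is nonempty, and the corresponding argument is 0. *)
move=> JN.
have : ~~ all (pred1 finset.set0) J.
  apply: contra JN => /all_pred1P J0; apply/eqP/val_inj.
  by rewrite /= J0 size_tuple.
rewrite -has_predC => /(has_nthP finset.set0)[j].
rewrite size_tuple => jk /= Jj.
rewrite (@mLeps_nth0 _ j) ?scaler0 //.
  by rewrite size_mkseq size_map size_zip size_map -sk size_tuple minnn.
have jz : (j < size (zip (map ocan_cst s) J))%N.
  by rewrite size_zip size_map -sk size_tuple minnn.
rewrite nth_mkseq ?size_map // (nth_map (ocan_cst 0, finset.set0)) //.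
rewrite nth_zip ?size_map ?size_tuple //= (nth_map 0) -?sk //.
apply/funext => b; rewrite /ltwist /ocan_cst (negPf Jj); exact: etwist0.
Qed.

End Operations.

(** * Tensor powers of tau *)

Lemma foldr_ohol_fun (T : Type) (f : T -> pt * pt -> C) (s : seq T) :
  foldr (@ohol_mul _ _ X) (@ohol_one _ _ X) [seq ohol_fun (f t) | t <- s] =
    ohol_fun (fun z => \prod_(t <- s) f t z).
Proof.
elim: s => [|t s IH] /=.
  by congr ohol_fun; apply/funext => z; rewrite big_nil.
by rewrite IH ohol_mul_fun; congr ohol_fun; apply/funext => z; rewrite big_cons.
Qed.

(* The signs eps_k of m_k^eps on degree-one classes produce (-1)^(k(k-1)/2). *)
Lemma tensor_power_tau k I z J b : base X z.1 ->
  \sum_(Ks : k.-tuple {set 'I_n})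
     otens_pure
       (foldr (@ohol_mul _ _ X) (@ohol_one _ _ X)
          (twist_seq (@ohol_one _ _ X) (@ohol_twist _ _ X)
             (psum [seq #|(Q : {set 'I_n})| | Q <- Ks])
             [seq tK.1 tK.2 | tK <- zip (nseq k (tau X)) Ks]))
       (ocan_m (map (@ocan_basis _ _ X) Ks)) I z J b =
  (J == finset.set0)%:R *
    ((-1) ^+ 'C(k, 2) * op X z.1 b (nseq k (tangent_vec z.2)) I).
Proof.
move=> zU; set beta := tangent_vec z.2.
(* The operator on the twisted copies of [beta] is computed twice: extracting the twists as scalars
   gives the sign, expanding in the basis gives the sum. *)
have -> : (-1) ^+ 'C(k, 2) * op X z.1 b (nseq k beta) I =
    \sum_(Ks : k.-tuple {set 'I_n}) \prod_(K <- Ks) beta K *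
      op X z.1 b
        (twist_seq 0 (@etwist R n) (fun j => k - j.+1)%N (map ebasis Ks)) I.
  have msk : size (mkseq (fun j => k - j.+1)%N k) = k by rewrite size_mkseq.
  have := op_expand zU b beta [::] msk.
  under [X in op _ _ _ (_ ++ X)]eq_map do rewrite etwist_eclass1.
  rewrite op_scale_seq // prodr_sign_triangular msk /=.
  move=> /(congr1 (fun a : E => a I)); rewrite ffunE sum_ffunE => prodE.
  apply: (etrans prodE); apply: eq_bigr => Ks _; rewrite ffunE.
  congr (_ * op X z.1 b _ I).
  apply: (@eq_from_nth _ 0) => [|j].
    by rewrite !(size_map, size_zip, size_mkseq, size_tuple) minnn.
  rewrite size_map size_zip size_mkseq size_tuple minnn => jk.
  have jz : (j < size (zip (mkseq (fun j => k - j.+1)%N k) Ks))%N.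
    by rewrite size_zip size_mkseq size_tuple minnn.
  rewrite (nth_map (0%N, finset.set0)) //.
  rewrite nth_zip ?size_mkseq ?size_tuple //=.
  rewrite !nth_mkseq ?size_map ?size_tuple //.
  by rewrite (nth_map finset.set0) ?size_tuple.
rewrite mulr_sumr; apply: eq_bigr => Ks _.
have -> : [seq tK.1 tK.2 | tK <- zip (nseq k (tau X)) Ks]
    = [seq ohol_fun (fun z => tangent_vec z.2 K) | K <- Ks].
  rewrite -{1}(size_tuple Ks); elim: (tval Ks) => //= K Ks' ->.
  by rewrite tauE.
(* The Koszul twists are trivial: the coefficients of tau have form degree 0. *)
rewrite twist_seq_id => [|j]; last first.
  by rewrite size_map => js; rewrite (nth_map finset.set0) // ohol_twist_fun.
rewrite foldr_ohol_fun otens_pure_funl.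
have -> : map (@ocan_basis _ _ X) Ks = map ocan_cst (map ebasis Ks).
  by rewrite -map_comp.
rewrite ocan_m_cst // ffunE size_map size_tuple -[_ *: _]/(_ * _).
case: eqP => [->|_]; last by rewrite !mul0r !mulr0.
by rewrite finset.cards0 muln0 !mul1r.
Qed.

(** * Derivatives of tau and the symplectic part of the curvature *)

Definition coord_sum (K : {set 'I_n}) (y : pt) : R :=
  \sum_(i < n) y 0 i * (K == [set i]%SET)%:R.

(** Exhibits real and imaginary parts, on which [smooth] and [cderive] are defined. *)
Lemma tangent_vecE K : (fun z : pt * pt => tangent_vec z.2 K) =
  fun z => Complex 0 (- coord_sum K z.2).
Proof.
apply/funext => z; move: z.2 => y.
have -> : Complex 0 (- coord_sum K y) = - 'i%C * (coord_sum K y)%:C%C.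
  by apply/eqP; rewrite eq_complex /=; apply/andP; split; apply/eqP; ring.
rewrite eclass1E /coord_sum rmorph_sum mulr_sumr; apply: eq_bigr => i _.
by rewrite rmorphM rmorph_nat mulrA.
Qed.

Lemma coord_sum_linear K (h : R) (v p : pt * pt) :
  coord_sum K (h *: v + p).2 = h * coord_sum K v.2 + coord_sum K p.2.
Proof.
rewrite /coord_sum mulr_sumr -big_split; apply: eq_bigr => i _ /=.
by rewrite !mxE mulrDl mulrA.
Qed.

Lemma coord_sum_continuous K : continuous (fun z : pt * pt => coord_sum K z.2).
Proof.
move=> z; apply: (@cvg_big _ _ +%R) => [|i _]; first exact: add_continuous.
apply: cvgM; last exact: cvg_cst.
apply: (@cvg_comp _ _ _ snd (fun y : pt => y 0 i) _ (nbhs z.2)).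
  exact: cvg_snd.
exact: coord_continuous.
Qed.

Lemma ohol_carrier_tangent_vec K :
  ohol_carrier (ohol_fun (fun z => tangent_vec z.2 K) : ohol X).
Proof.
rewrite tangent_vecE.
have opp_linear h (v p : pt * pt) :
    - coord_sum K (h *: v + p).2 = h * - coord_sum K v.2 + - coord_sum K p.2.
  by rewrite coord_sum_linear; ring.
move=> J; split => [b k|e].
  rewrite /ohol_fun; case: (_ && _) => /=; last by split; exact: Ck_cst.
  split => /=; first exact: Ck_cst.
  by apply: Ck_linear => // z; apply: cvgN; exact: coord_sum_continuous.
apply: (@sub_finite_set _ _ [set 0]); last exact: finite_set1.
move=> b [[z _]]; rewrite /ohol_fun; case: (eqVneq b 0) => [->//|_].
by rewrite andbF eqxx.
Qed.

Lemma cderive_cst (V : normedModType R) (c : C) (v p : V) :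
  cderive (fun=> c) v p = 0.
Proof. by rewrite /cderive /= !derive_cst. Qed.

(** The coefficient is linear in y and independent of x, so its derivative is its value on the
    direction. *)
Lemma cderive_tangent_vec K (u v : pt) p :
  cderive (fun z : pt * pt => tangent_vec z.2 K) (u, v) p = tangent_vec v K.
Proof.
have := congr1 (fun f => f (0, v)) (tangent_vecE K) => /= ->.
rewrite tangent_vecE /cderive /= derive_cst; congr Complex.
apply: derive_val; apply: is_derive_linear => h w q.
by rewrite coord_sum_linear; ring.
Qed.

(* The (1, 1) part of dbar tau, namely sum_i dx_i (x) e_i. *)
Definition canonical_form (I J : {set 'I_n}) (b : G) : C :=
  (b == 0)%:R * \sum_(i < n) (J == [set i]%SET)%:R * (I == [set i]%SET)%:R.

(** Neither d/dx_i nor the boundary term contributes, as tau is constant in x and sits at T^0; what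
    remains is 'i d/dy_i (-'i y_i) = 1. *)
Lemma ohol_dbar_tau I z J b :
  ohol_dbar (tau X I) z J b = canonical_form I J b.
Proof.
rewrite tauE /ohol_dbar /canonical_form mulr_sumr big_mkcond.
(* The coefficients of tau are functions, so the dx_i term reaches only J = {i}. *)
apply: eq_bigr => i _; case: (eqVneq J [set i]%SET) => [->|Ji]; last first.
  rewrite mul0r mulr0; case: ifP => // iJ; rewrite /ohol_fun.
  have /negPf-> : (J :\ i)%SET != finset.set0.
    apply: contra Ji => /eqP Ji0.
    by rewrite -(finset.setD1K iJ) Ji0 finset.setU0.
  by rewrite !cderive_cst !mulr0 subrr addr0 mulr0.
rewrite finset.set11 finset.setDv wsign0r !mul1r /ohol_fun eqxx /=.
case: (eqVneq b 0) => [->|_]; last first.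
  by rewrite !cderive_cst !mulr0 subrr addr0 mul0r.
rewrite !cderive_tangent_vec bdry0 mxE mul0r subr0 mul1r !eclass1E.
rewrite big1 ?add0r => [|j _]; last by rewrite mxE mulr0 mul0r.
rewrite (bigD1 i) //= big1 ?addr0 => [|j ji]; last first.
  by rewrite !mxE (negPf ji) mulr0 mul0r.
rewrite !mxE !eqxx mulr1 mulrA mulrN -expr2 sqr_i opprK.
by rewrite mul1r.
Qed.

Lemma ocan_omegaE (x : pt) I J b :
  ocan_omega x J b I = - canonical_form I J b.
Proof.
rewrite /ocan_omega /canonical_form; case: eqP => _; last first.
  by rewrite mul0r oppr0 ffunE.
rewrite mul1r ffunE sum_ffunE; congr (- _); apply: eq_bigr => i _.
by rewrite !ffunE.
Qed.

(** The support has |I| = |J| = 1, where exchanging e_i and dx_i costs -1. This sign makes the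
    curvature -omega cancel dbar tau. *)
Lemma canonical_form_sign (I J : {set 'I_n}) b :
  (-1) ^+ (#|I| * #|J|) * canonical_form I J b = - canonical_form I J b.
Proof.
rewrite /canonical_form mulrCA -mulrN mulr_sumr -sumrN; congr (_ * _).
apply: eq_bigr => i _.
case: (eqVneq J [set i]%SET) => [->|_]; last by rewrite !mul0r mulr0 oppr0.
case: (eqVneq I [set i]%SET) => [->|_]; last by rewrite !mulr0 oppr0.
by rewrite finset.cards1 !mulr1 expr1.
Qed.

(** The e_K are flat, and T^0 has zero boundary. *)
Lemma ocan_nabla_basis K x J b : ocan_nabla (@ocan_basis _ _ X K) x J b = 0.
Proof.
apply/ffunP => I; rewrite !ffunE big1 ?mulr0 // => i _.
rewrite (@cderive_cst _ (@ocan_basis _ _ X K x (J :\ i)%SET b I)) sub0r.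
rewrite /ocan_basis; case: (eqVneq b 0) => [->|_].
  by rewrite bdry0 mxE mul0r oppr0 mulr0.
by rewrite andbF ffunE mulr0 oppr0 mulr0.
Qed.

(** * The terms of the Maurer-Cartan sum *)

Lemma potential_tangent (x y : pt) b : base X x ->
  potential x (@tangent_class _ _ X y) b =
    csum (fun k => op X x b (nseq k (tangent_vec y)) finset.set0).
Proof.
move=> xU; congr csum; apply/funext => k.
by rewrite -mL_cst // map_nseq.
Qed.

(** For at least two arguments [ocan_op] is [ocan_m], but this reduces only once the tuple [Ks] is
    destructed. *)
Lemma otens_op_geq2 (s : seq (otens X)) I z J b : (1 < size s)%N ->
  otens_op s I z J b = \sum_(Ks : (size s).-tuple {set 'I_n})
     otens_pure
       (foldr (@ohol_mul _ _ X) (@ohol_one _ _ X)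
          (twist_seq (@ohol_one _ _ X) (@ohol_twist _ _ X)
             (psum [seq #|(Q : {set 'I_n})| | Q <- Ks])
             [seq tK.1 tK.2 | tK <- zip s Ks]))
       (ocan_m (map (@ocan_basis _ _ X) Ks)) I z J b.
Proof.
by case: s => [|t [|t' s]] //= _; apply: eq_bigr => -[[|K [|K' Ks]] sz] _ //=.
Qed.

(** Shaped for [csum_to_head]: the term k = 0 carries the curvatures -W and -omega, and k = 1
    carries dbar tau. *)
Lemma otens_op_tau k I z J b : base X z.1 ->
  (-1) ^+ ((k * k.-1)./2) * otens_op (nseq k (tau X)) I z J b =
    (J == finset.set0)%:R * op X z.1 b (nseq k (tangent_vec z.2)) I
    - (k == 0%N)%:R *
       (((J == finset.set0) && (I == finset.set0))%:R *
          csum (fun k => op X z.1 b (nseq k (tangent_vec z.2)) finset.set0)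
        + canonical_form I J b)
    + (k == 1%N)%:R * canonical_form I J b.
Proof.
move=> zU; rewrite -bin2; case: k => [|[|k]].
- rewrite expr0 mul1r mul0r addr0 mul1r /= otens_pure_funl /= otens_pure_cstr.
  rewrite !ffunE ocan_omegaE mul1r mulrDr opprK canonical_form_sign.
  rewrite (@ocan_m_cst _ zU [::]) ffunE -[_ *: _]/(_ * _).
  rewrite /ohol_curv potential_tangent //.
  case: (J =P _) => [->|_] /=; last by rewrite !mul0r mulr0; ring.
  by rewrite finset.cards0 muln0 expr0; ring.
- rewrite expr0 !mul1r mul0r subr0 /= big_split /= [LHS]addrC; congr (_ + _).
    (* The contribution of m_1 is the tensor power k = 1, since the connection vanishes on basis
       elements. *)
    have := @tensor_power_tau 1 I z J b zU.
    rewrite expr0 mul1r => <-; rewrite big_tuple_cons; apply: eq_bigr => K _.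
    rewrite big_tuple0 /= tauE !ohol_twist_fun ohol_mul_fun.
    rewrite !otens_pure_funl mulr1.
    by congr (_ * (_ * _)); rewrite ocan_nabla_basis addr0.
  rewrite (bigD1 I) //= big1 ?addr0 => [|K KI]; rewrite otens_pure_cstr ffunE.
    by rewrite eqxx mulr1 ohol_dbar_tau.
  by rewrite eq_sym (negPf KI) mulr0.
rewrite !mul0r subr0 addr0.
(* The sign of the Maurer-Cartan equation meets the equal sign coming from eps_k, and their product
   is 1. *)
transitivity ((-1) ^+ 'C(k.+2, 2) * ((J == finset.set0)%:R *
    ((-1) ^+ 'C(k.+2, 2) * op X z.1 b (nseq k.+2 (tangent_vec z.2)) I))).
  congr (_ * _); rewrite -tensor_power_tau //.
  rewrite otens_op_geq2 ?size_nseq //.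
by rewrite mulrCA signrMK.
Qed.

End Tangent.

Theorem lemma1p3 (R : realType) (n : nat) (X : fukaya_data R n)
    (hwu : weakly_unobstructed X) :
  (forall (A : 'M[int]_n) (y' : 'I_n -> 'rV[R]_n * 'rV[R]_n -> R)
          (e' : 'I_n -> ext R n),
     affine_change A y' e' -> tau_of X y' e' = tau X) /\
  maurer_cartan (tau X).
Proof.
split; first exact: tau_of_affine.
split=> [I|I z J b _|I z J b zU].
- by rewrite tauE; exact: ohol_carrier_tangent_vec.
- rewrite tauE /ohol_fun.
  case: (eqVneq J finset.set0) => [->|_] /=; last by rewrite eqxx.
  case: (eqVneq b 0) => [->|_]; last by rewrite eqxx.
  have [I1|I1] := eqVneq #|I| 1%N; last by rewrite eclass1_degree // eqxx.
  by rewrite I1 finset.cards0 maslov0.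
under [X in csum_to X _]eq_fun do rewrite otens_op_tau //.
apply: csum_to_head.
have [c [_ cE]] := hwu _ zU.
(* The divisor equation reduces every term to m_0, which weak unobstructedness makes a multiple of
   1; the terms are those of an exponential series. *)
have opE k K : op X z.1 b (nseq k (tangent_vec z.2)) K =
    (\sum_(i < n) - 'i%C * (z.2 0 i)%:C%C * (bdry b 0 i)%:~R) ^+ k / (k`!)%:R *
      (c b * (K == finset.set0)%:R).
  have op0 : op X z.1 b [::] = (c b : R[i]) *: (eone : ext R n).
    by rewrite -(mL_cst zU [::]) cE.
  by rewrite op_divisor_power // op0 !ffunE.
(* Outside I = J = empty both the expected sum and every term are 0. *)
have [JI|JI] := boolP (_ && _); last first.
  rewrite mul0r; under eq_fun => k.
    rewrite opE (_ : _ * _ = 0); last first.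
      move: JI; case: (J == _); case: (I == _) => // _;
        by rewrite ?mul0r ?mulr0.
    over.
  by split; apply: cvg_near_cst; apply: nearW => k /=; rewrite /series /= big1.
have /andP[/eqP-> /eqP->] := JI; rewrite mul1r.
under eq_fun do rewrite eqxx mul1r.
(* [csum] is by definition the limit, so only convergence is left. *)
by split; apply: cvgP; under eq_fun do rewrite opE;
  [exact: cvg_series_Re_exp|exact: cvg_series_Im_exp].
Qed.
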